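(* Let $\mathcal{I}_{BLip}$ be a two-Lipschitz operator ideal. Then the class $\overline{\mathcal{I}_{BLip}}$ whose components are defined by $$\overline{\mathcal{I}_{BLip}}(X_1,X_2;E):=\overline{\mathcal{I}_{BLip}(X_1,X_2;E)}^{\,BLip(\cdot)}$$ (the closure of $\mathcal{I}_{BLip}(X_1,X_2;E)$ in $BLip_0(X_1,X_2;E)$ with respect to the norm $BLip(\cdot)$), for all pointed metric spaces $X_1,X_2$ and all Banach spaces $E$, is a two-Lipschitz operator ideal.
   Context: Let $\mathbb{K}$ be $\mathbb{R}$ or $\mathbb{C}$; all Banach spaces are over $\mathbb{K}$. A pointed metric space is a metric space with a distinguished base point $0$. $Lip_0(X,Y)$ is the set of Lipschitz maps $T:X\to Y$ with $T(0)=0$; $X^{\#}=Lip_0(X,\mathbb{K})$. $\mathcal{L}(E,F)$ is the space of bounded linear operators. Two-Lipschitz operators: a map $T:X_1\times X_2\to E$ ($X_1,X_2$ pointed metric spaces, $E$ Banach) belongs to $BLip_0(X_1,X_2;E)$ if $T(x_1,0)=T(0,x_2)=0$ for all $x_1,x_2$ and there is $C>0$ with $\|T(x_1,x_2)-T(x_1,x_2')-T(x_1',x_2)+T(x_1',x_2')\|\le C\,d(x_1,x_1')d(x_2,x_2')$ for all $x_1,x_1'\in X_1$, $x_2,x_2'\in X_2$. The least such $C$ is $BLip(T)$; this is a Banach space norm on $BLip_0(X_1,X_2;E)$. A two-Lipschitz operator ideal $\mathcal{I}_{BLip}$ is a subclass of $BLip_0$ such that for all pointed metric spaces $X_1,X_2$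 and Banach spaces $E$ the components $\mathcal{I}_{BLip}(X_1,X_2;E):=BLip_0(X_1,X_2;E)\cap\mathcal{I}_{BLip}$ satisfy: (i) $\mathcal{I}_{BLip}(X_1,X_2;E)$ is a linear subspace of $BLip_0(X_1,X_2;E)$; (ii) for $f_1\in X_1^{\#}$, $f_2\in X_2^{\#}$, $e\in E$, the map $f_1\cdot f_2\cdot e:(x_1,x_2)\mapsto f_1(x_1)f_2(x_2)e$ belongs to $\mathcal{I}_{BLip}(X_1,X_2;E)$; (iii) if $f_1\in Lip_0(Z,X_1)$, $f_2\in Lip_0(W,X_2)$ ($Z,W$ pointed metric spaces), $T\in\mathcal{I}_{BLip}(X_1,X_2;E)$ and $u\in\mathcal{L}(E,F)$, then $u\circ T\circ(f_1,f_2)\in\mathcal{I}_{BLip}(Z,W;F)$. *)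

(* Defs.v *)
From HB Require Import structures.
From mathcomp Require Import all_boot all_order all_algebra.
From mathcomp Require Import complex.
From mathcomp Require Import all_classical all_reals all_analysis.

Set Implicit Arguments.
Unset Strict Implicit.
Unset Printing Implicit Defensive.

Import Order.TTheory GRing.Theory Num.Theory.
Import numFieldNormedType.Exports.

Local Open Scope classical_set_scope.
Local Open Scope complex_scope.
Local Open Scope ring_scope.

Variant scalar_kind := RealScalars | ComplexScalars.

Definition scalars (R : realType) (s : scalar_kind) : numFieldType :=
  match s with
  | RealScalars => R
  | ComplexScalars => R[i]
  end.

(* The norm of a normed module over K takes its values in K, as nonnegative
   and hence real elements; metrics and Lipschitz constants live in R, so the
   norm is brought back to R. *)
Definition real_part (R : realType) (s : scalar_kind) : scalars R s -> R :=
  match s with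
  | RealScalars => fun x => x
  | ComplexScalars => fun z => complex.Re z
  end.

Definition rnorm (R : realType) (s : scalar_kind)
    (E : normedZmodType (scalars R s)) (x : E) : R :=
  real_part `|x|.

(* The base point is [point]. *)
#[short(type="pointedMetricType")]
HB.structure Definition PointedMetric (R : numDomainType) :=
  { M of Metric R M & Pointed M }.

Section Lipschitz.
Context {R : realType}.

Definition Lip0 (X Y : pointedMetricType R) : set (X -> Y) :=
  [set f | f point = point /\
    exists C : R, forall x x', mdist (f x) (f x') <= C * mdist x x'].

Definition lipschitz_dual (s : scalar_kind) (X : pointedMetricType R) :
    set (X -> scalars R s) :=
  [set f | f point = 0 /\
    exists C : R, forall x x', rnorm (f x - f x') <= C * mdist x x'].

Definition bounded_operator (s : scalar_kind)
    (E F : completeNormedModType (scalars R s)) (u : {linear E -> F}) : Prop :=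
  exists C : R, forall x, rnorm (u x) <= C * rnorm x.

End Lipschitz.

Section TwoLipschitz.
Context {R : realType} {s : scalar_kind}.
Context {X1 X2 : pointedMetricType R} {E : completeNormedModType (scalars R s)}.
Implicit Types (T : X1 * X2 -> E) (C : R).

Definition two_lipschitz_bound T C : Prop :=
  forall x1 x1' x2 x2',
    rnorm (T (x1, x2) - T (x1, x2') - T (x1', x2) + T (x1', x2')) <=
    C * mdist x1 x1' * mdist x2 x2'.

Definition BLip0 : set (X1 * X2 -> E) :=
  [set T | [/\ forall x1, T (x1, point) = 0,
               forall x2, T (point, x2) = 0 &
               exists2 C, 0 < C & two_lipschitz_bound T C]].

(* An infimum rather than a minimum: for T = 0 no least C > 0 exists. *)
Definition BLip T : R := inf [set C | 0 < C /\ two_lipschitz_bound T C].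

Definition BLip_closure (A : set (X1 * X2 -> E)) : set (X1 * X2 -> E) :=
  [set T | BLip0 T /\
    forall e : R, 0 < e -> exists2 S, (A `&` BLip0) S & BLip (T - S) < e].

End TwoLipschitz.

Arguments BLip0 {R s} X1 X2 E.

Definition operator_class (R : realType) (s : scalar_kind) :=
  forall (X1 X2 : pointedMetricType R) (E : completeNormedModType (scalars R s)),
    set (X1 * X2 -> E).

Record two_lipschitz_ideal (R : realType) (s : scalar_kind)
    (I : operator_class R s) : Prop := TwoLipschitzIdeal {
  ideal_sub_BLip0 : forall (X1 X2 : pointedMetricType R)
      (E : completeNormedModType (scalars R s)), I X1 X2 E `<=` BLip0 X1 X2 E ;
  ideal0 : forall (X1 X2 : pointedMetricType R)
      (E : completeNormedModType (scalars R s)), I X1 X2 E 0 ;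
  idealD : forall (X1 X2 : pointedMetricType R)
      (E : completeNormedModType (scalars R s)) (T S : X1 * X2 -> E),
    I X1 X2 E T -> I X1 X2 E S -> I X1 X2 E (T + S) ;
  idealZ : forall (X1 X2 : pointedMetricType R)
      (E : completeNormedModType (scalars R s)) (a : scalars R s) (T : X1 * X2 -> E),
    I X1 X2 E T -> I X1 X2 E (a *: T) ;
  ideal_elementary : forall (X1 X2 : pointedMetricType R)
      (E : completeNormedModType (scalars R s))
      (f1 : X1 -> scalars R s) (f2 : X2 -> scalars R s) (e : E),
    lipschitz_dual f1 -> lipschitz_dual f2 ->
    I X1 X2 E (fun x => (f1 x.1 * f2 x.2) *: e) ;
  ideal_comp : forall (X1 X2 Z W : pointedMetricType R)
      (E F : completeNormedModType (scalars R s))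
      (f1 : Z -> X1) (f2 : W -> X2) (T : X1 * X2 -> E) (u : {linear E -> F}),
    Lip0 f1 -> Lip0 f2 -> I X1 X2 E T -> bounded_operator u ->
    I Z W F (fun x => u (T (f1 x.1, f2 x.2)))
}.

Definition ideal_closure (R : realType) (s : scalar_kind)
    (I : operator_class R s) : operator_class R s :=
  fun X1 X2 E => BLip_closure (I X1 X2 E).

(* Main.v *)
Require Import Defs.
From mathcomp Require Import all_boot all_order all_algebra.
From mathcomp Require Import all_classical all_reals all_analysis.
From mathcomp Require Import complex ring.

(** The closure is taken in a norm for which every operation of an ideal is
    continuous.  The difference
    [T (x1, x2) - T (x1, x2') - T (x1', x2) + T (x1', x2')] is linear in [T],
    so the admissible two-Lipschitz constants add up under sums
    ([two_lipschitz_boundD]), and they are multiplied by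
    [||u|| Lip(f1) Lip(f2)] when [T] is replaced by [u o T o (f1, f2)]
    ([two_lipschitz_bound_comp]).  Hence if [S] in the ideal approximates [T],
    the same operation applied to [S] stays in the ideal and approximates the
    operation applied to [T], with an error enlarged by a factor independent
    of [S]; starting from a small enough error absorbs this factor.
    Multiplication by a scalar [a] is the composition with the bounded operator
    [x |-> a x], and elementary maps lie in the closure because the ideal
    itself does ([sub_BLip_closure]).

    The infimum defining [BLip] is dealt with once and for all by
    [BLip_closureP], which replaces [BLip (T - S) < e] by the statement that
    [e] is an admissible constant for [T - S]. *)

Set Implicit Arguments.
Unset Strict Implicit.
Unset Printing Implicit Defensive.

Import Order.TTheory GRing.Theory Num.Theory.
Import numFieldNormedType.Exports.

Local Open Scope classical_set_scope.
Local Open Scope ring_scope.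

(** * The real-valued norm *)

Section RealNorm.
Context {R : realType} {s : scalar_kind}.

Lemma real_partD (x y : scalars R s) :
  real_part (x + y) = real_part x + real_part y.
Proof. by case: s x y => //= -[a b] [c d]. Qed.

Lemma real_part_le (x y : scalars R s) :
  x <= y -> real_part x <= real_part y.
Proof. by case: s x y => //= -[a b] [c d]; rewrite lecE => /andP[]. Qed.

(** A nonnegative complex number is real, so no product of imaginary parts
    appears. *)
Lemma real_partM (x y : scalars R s) : 0 <= x ->
  real_part (x * y) = real_part x * real_part y.
Proof.
case: s x y => //= -[a b] [c d]; rewrite lecE /= => /andP[/eqP -> _].
by rewrite mul0r subr0.
Qed.

Lemma real_part0 : real_part (0 : scalars R s) = 0.
Proof. by case: s. Qed.

Section NormedZmodule.
Context {E : normedZmodType (scalars R s)}.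

Lemma rnorm_ge0 (x : E) : 0 <= rnorm x.
Proof. by rewrite -real_part0; apply/real_part_le/normr_ge0. Qed.

Lemma rnorm0 : rnorm (0 : E) = 0.
Proof. by rewrite /rnorm normr0 real_part0. Qed.

Lemma ler_rnormD (x y : E) : rnorm (x + y) <= rnorm x + rnorm y.
Proof. by rewrite /rnorm -real_partD; apply/real_part_le/ler_normD. Qed.

End NormedZmodule.

Lemma rnormZ (E : normedModType (scalars R s)) (a : scalars R s) (x : E) :
  rnorm (a *: x) = rnorm a * rnorm x.
Proof. by rewrite /rnorm normrZ real_partM. Qed.

Lemma bounded_operator_scale (E : completeNormedModType (scalars R s))
  (a : scalars R s) : bounded_operator (GRing.scale a : {linear E -> E}).
Proof. by exists (rnorm a) => x; rewrite rnormZ. Qed.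

End RealNorm.

(** * Positive Lipschitz and operator constants *)

(** Lipschitz and operator bounds come with a constant of arbitrary sign; a
    positive one can be divided by. *)
Lemma pos_constant (R : realType) (T : Type) (a b : T -> R) (C : R) :
  (forall t, 0 <= b t) -> (forall t, a t <= C * b t) ->
  exists2 D, 0 < D & forall t, a t <= D * b t.
Proof.
move=> b0 aCb; exists (Num.max C 1); first by rewrite lt_max ltr01 orbT.
by move=> t; rewrite (le_trans (aCb t))// ler_wpM2r// le_max lexx.
Qed.

Lemma Lip0_pos_constant (R : realType) (X Y : pointedMetricType R)
  (f : X -> Y) : Lip0 f ->
  exists2 C : R, 0 < C & forall x x', mdist (f x) (f x') <= C * mdist x x'.
Proof.
move=> [_ [C fC]].
have [|xx|D D0 fD] := @pos_constant R (X * X)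
    (fun x => mdist (f x.1) (f x.2)) (fun x => mdist x.1 x.2) C.
- by move=> x; exact: mdist_ge0.
- exact: fC.
- by exists D => // x x'; exact: (fD (x, x')).
Qed.

Lemma Lip0_id (R : realType) (X : pointedMetricType R) : Lip0 (@id X).
Proof. by split=> //; exists 1 => x x'; rewrite mul1r. Qed.

(** * Two-Lipschitz constants of sums *)

Section TwoLipschitz.
Context {R : realType} {s : scalar_kind}.
Context {X1 X2 : pointedMetricType R} {E : completeNormedModType (scalars R s)}.
Implicit Types (T S : X1 * X2 -> E) (C D : R).

Lemma two_lipschitz_bound0 C : 0 <= C ->
  two_lipschitz_bound (0 : X1 * X2 -> E) C.
Proof.
move=> C0 x1 x1' x2 x2'; rewrite /GRing.zero /= !subr0 addr0 rnorm0.
by rewrite !mulr_ge0// mdist_ge0.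
Qed.

Lemma two_lipschitz_bound_le T C D :
  C <= D -> two_lipschitz_bound T C -> two_lipschitz_bound T D.
Proof.
move=> CD TC x1 x1' x2 x2'; apply: le_trans (TC _ _ _ _) _.
by rewrite !ler_wpM2r// mdist_ge0.
Qed.

Lemma two_lipschitz_boundD T S C D :
  two_lipschitz_bound T C -> two_lipschitz_bound S D ->
  two_lipschitz_bound (T + S) (C + D).
Proof.
move=> TC SD x1 x1' x2 x2'.
have TSE p : (T + S) p = T p + S p by [].
rewrite !mulrDl; apply: le_trans (lerD (TC _ _ _ _) (SD _ _ _ _)).
apply: le_trans (ler_rnormD _ _); rewrite !TSE !opprD.
by rewrite [X in rnorm X <= _](AC (2*2*2*2) ((1*3*5*7)*(2*4*6*8))).
Qed.

Lemma BLip0D T S :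
  BLip0 X1 X2 E T -> BLip0 X1 X2 E S -> BLip0 X1 X2 E (T + S).
Proof.
have TSE p : (T + S) p = T p + S p by [].
move=> [T1 T2 [C C0 TC]] [S1 S2 [D D0 SD]]; split.
- by move=> x; rewrite TSE T1 S1 addr0.
- by move=> x; rewrite TSE T2 S2 addr0.
- by exists (C + D); [exact: addr_gt0 | exact: two_lipschitz_boundD].
Qed.

End TwoLipschitz.

(** * Two-Lipschitz constants of compositions *)

Section Composition.
Context {R : realType} {s : scalar_kind}.
Context {X1 X2 Z W : pointedMetricType R}.
Context {E F : completeNormedModType (scalars R s)}.
Context {f1 : Z -> X1} {f2 : W -> X2} {u : {linear E -> F}}.
Implicit Types T : X1 * X2 -> E.

(** By linearity of [u], the mixed difference of the composition is the image
    under [u] of a mixed difference of [T].  The factor [k] depends on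
    [f1], [f2] and [u] only, which makes the composition continuous in [T]. *)
Lemma two_lipschitz_bound_comp :
  Lip0 f1 -> Lip0 f2 -> bounded_operator u ->
  exists2 k : R, 0 < k & forall T C, 0 <= C -> two_lipschitz_bound T C ->
    two_lipschitz_bound (fun x => u (T (f1 x.1, f2 x.2))) (k * C).
Proof.
move=> /Lip0_pos_constant[C1 C10 f1C] /Lip0_pos_constant[C2 C20 f2C] [C' uC'].
have [D D0 uD] := pos_constant (fun x : E => rnorm_ge0 x) uC'.
exists (D * C1 * C2) => [|T C C0 TC x1 x1' x2 x2' /=]; first by rewrite !mulr_gt0.
rewrite -!linearB -linearD; apply: le_trans (uD _) _.
rewrite [leRHS](_ : _ = D * (C * (C1 * mdist x1 x1') * (C2 * mdist x2 x2')));
  last by ring.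
rewrite ler_wpM2l ?(ltW D0)//; apply: le_trans (TC _ _ _ _) _.
apply: ler_pM => //; rewrite ?mulr_ge0 ?mdist_ge0//.
by rewrite ler_wpM2l.
Qed.

Lemma BLip0_comp T :
  Lip0 f1 -> Lip0 f2 -> bounded_operator u -> BLip0 X1 X2 E T ->
  BLip0 Z W F (fun x => u (T (f1 x.1, f2 x.2))).
Proof.
move=> hf1 hf2 hu [T1 T2 [C C0 TC]]; split=> [x|x|] /=.
- by rewrite (proj1 hf2) T1 linear0.
- by rewrite (proj1 hf1) T2 linear0.
have [k k0 kP] := two_lipschitz_bound_comp hf1 hf2 hu.
by exists (k * C); [exact: mulr_gt0 | exact: kP (ltW C0) TC].
Qed.

End Composition.

(** * The closure in the two-Lipschitz norm *)

Section Closure.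
Context {R : realType} {s : scalar_kind}.
Context {X1 X2 : pointedMetricType R} {E : completeNormedModType (scalars R s)}.
Implicit Types (T S : X1 * X2 -> E) (A : set (X1 * X2 -> E)).

(** The form in which closure under scalars is an instance of closure under
    composition. *)
Lemma scale_compE (a : scalars R s) T :
  a *: T = (fun x => ( *:%R a : {linear E -> E}) (T (id x.1, id x.2))).
Proof. by apply/funext => -[]. Qed.

Lemma BLip0B T S :
  BLip0 X1 X2 E T -> BLip0 X1 X2 E S -> BLip0 X1 X2 E (T - S).
Proof.
move=> hT hS; apply: BLip0D => //; rewrite -scaleN1r scale_compE.
exact: (BLip0_comp (Lip0_id X1) (Lip0_id X2) (bounded_operator_scale E (-1)) hS).
Qed.

(** An infimum below [e] gives an admissible constant below [e] only if some
    constant is admissible, as the infimum of the empty set is [0]; hence the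
    hypothesis [BLip0 X1 X2 E T]. *)
Lemma BLip_lt T e : BLip0 X1 X2 E T -> BLip T < e -> two_lipschitz_bound T e.
Proof.
move=> [_ _ [C C0 TC]] /inf_lt[|D [_ TD] /ltW De]; first by exists C.
exact: two_lipschitz_bound_le De TD.
Qed.

Lemma BLip_le T (C : R) : 0 < C -> two_lipschitz_bound T C -> BLip T <= C.
Proof. by move=> C0 TC; apply: ge_inf => //; exists 0 => D [/ltW]. Qed.

Lemma BLip_closureP A T : A `<=` BLip0 X1 X2 E ->
  BLip_closure A T <-> BLip0 X1 X2 E T /\
    forall e : R, 0 < e -> exists2 S, A S & two_lipschitz_bound (T - S) e.
Proof.
move=> AB; split=> -[hT TA]; split=> // e e0.
  have [S [AS hS] TSe] := TA e e0.
  by exists S => //; apply: BLip_lt TSe; exact: BLip0B.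
have e20 : 0 < e / 2 by rewrite divr_gt0.
have [S AS TSe] := TA _ e20; exists S; first by split=> //; exact: AB.
(* A bound by [e] would only give [BLip (T - S) <= e]. *)
by rewrite (le_lt_trans (BLip_le e20 TSe))// ltr_pdivrMr// ltr_pMr// ltr1n.
Qed.

Lemma sub_BLip_closure A : A `<=` BLip0 X1 X2 E -> A `<=` BLip_closure A.
Proof.
move=> AB T AT; apply/BLip_closureP => //; split; first exact: AB.
move=> e e0; exists T => //; rewrite subrr.
exact/two_lipschitz_bound0/ltW.
Qed.

End Closure.

(** * The closure of an ideal *)

Section ClosureOfIdeal.
Context {R : realType} {s : scalar_kind} {I : operator_class R s}.
Context (hI : two_lipschitz_ideal I).

Lemma ideal_closureD (X1 X2 : pointedMetricType R)
    (E : completeNormedModType (scalars R s)) (T S : X1 * X2 -> E) :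
  ideal_closure I T -> ideal_closure I S -> ideal_closure I (T + S).
Proof.
have IB := ideal_sub_BLip0 hI (X1 := X1) (X2 := X2) (E := E).
move=> /(BLip_closureP _ IB)[hT TI] /(BLip_closureP _ IB)[hS SI].
apply/(BLip_closureP _ IB); split; first exact: BLip0D.
move=> e e0; have e20 : 0 < e / 2 by rewrite divr_gt0.
have [T' IT' TT'] := TI _ e20; have [S' IS' SS'] := SI _ e20.
exists (T' + S'); first exact: (idealD hI).
by rewrite opprD addrACA [e]splitr; exact: two_lipschitz_boundD.
Qed.

Lemma ideal_closure_comp (X1 X2 Z W : pointedMetricType R)
    (E F : completeNormedModType (scalars R s))
    (f1 : Z -> X1) (f2 : W -> X2) (T : X1 * X2 -> E) (u : {linear E -> F}) :
  Lip0 f1 -> Lip0 f2 -> ideal_closure I T -> bounded_operator u ->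
  ideal_closure I (fun x => u (T (f1 x.1, f2 x.2))).
Proof.
move=> hf1 hf2 /(BLip_closureP _ (ideal_sub_BLip0 hI (E := E)))[hT TI] hu.
apply/(BLip_closureP _ (ideal_sub_BLip0 hI (E := F))).
split; first exact: (BLip0_comp hf1 hf2 hu hT).
have [k k0 kP] := two_lipschitz_bound_comp hf1 hf2 hu.
move=> e e0; have ek0 : 0 < e / k by rewrite divr_gt0.
have [S IS TS] := TI _ ek0.
exists (fun x => u (S (f1 x.1, f2 x.2))); first exact: (ideal_comp hI hf1 hf2 IS hu).
rewrite [X in two_lipschitz_bound X](_ : _ =
    fun x => u ((T - S) (f1 x.1, f2 x.2))); last first.
  by apply/funext => x; rewrite [(T - S) _]/(T _ - S _) linearB.
by rewrite -(divfK (lt0r_neq0 k0) e) mulrC; exact: kP (ltW ek0) TS.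
Qed.

Lemma ideal_closureZ (X1 X2 : pointedMetricType R)
    (E : completeNormedModType (scalars R s)) (a : scalars R s)
    (T : X1 * X2 -> E) :
  ideal_closure I T -> ideal_closure I (a *: T).
Proof.
move=> hT; rewrite scale_compE.
exact: (ideal_closure_comp (Lip0_id X1) (Lip0_id X2) hT
  (bounded_operator_scale E a)).
Qed.

End ClosureOfIdeal.

Theorem proposition3p2 (R : realType) (s : scalar_kind)
    (I : operator_class R s) (hI : two_lipschitz_ideal I) :
  two_lipschitz_ideal (ideal_closure I).
Proof.
have subI X1 X2 E : I X1 X2 E `<=` ideal_closure I (E := E).
  exact/sub_BLip_closure/ideal_sub_BLip0.
split.
- by move=> X1 X2 E T [].
- by move=> X1 X2 E; apply: subI; exact: (ideal0 hI).
- exact: ideal_closureD hI.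
- exact: ideal_closureZ hI.
- by move=> X1 X2 E f1 f2 e hf1 hf2; apply: subI; exact: (ideal_elementary hI).
- exact: ideal_closure_comp hI.
Qed.
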